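(* Let $p$ be a prime and let $d\ge 2$ be an integer coprime to $p$. Let $r$ be the multiplicative order of $p$ modulo $2d$ if $p$ is odd, and modulo $d$ if $p=2$. Let $E$ be any infinite set of positive integers coprime to $d$ which is closed under taking (positive) divisors and least common multiples. Then the infinite generalised Paley graph $P_d(p^{rE})$ is isomorphic to the countable random graph $R$.
   Context: All graphs are undirected, without loops or multiple edges. Generalised Paley graphs: let $q$ be a prime power and $d$ a divisor of $q-1$ such that, if $q$ is odd, $(q-1)/d$ is even. The generalised Paley graph $P_d(q)$ has vertex set the finite field $\mathbb{F}_q$ with $q$ elements, two vertices $x,y$ being adjacent if and only if $x-y$ lies in the unique subgroup $D$ of index $d$ in the multiplicative group $\mathbb{F}_q^*$, that is, the subgroup consisting of the non-zero $d$th powers. Infinite generalised Paley graphs: let $p$, $d$, $r$ and $E$ be as in the claim, so for every $e\in E$ the integer $d$ divides $p^{re}-1$ and, if $p$ is odd, $(p^{re}-1)/d$ is even, and hence the generalised Paley graph $P_d(p^{re})$ is defined. Regard the finite fields $\mathbb{F}_{p^{re}}$, $e\in E$, as subfields of a fixed algebraic closure of $\mathbb{F}_p$, so that $\mathbb{F}_{p^{re}}\subseteq\mathbb{F}_{p^{rf}}$ whenever $e$ divides $f$. For $e\mid f$ in $E$, $P_d(p^{re})$ is an induced subgraph of $P_d(p^{rf})$. The infinite generalised Paley graph is the union (direct limit) $P_d(p^{rE}):=\bigcup_{e\in E}P_d(p^{re})$: its vertex set is $\mathbb{F}_{p^{rE}}:=\bigcup_{e\in E}\mathbb{F}_{p^{re}}$,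 and two vertices are adjacent if and only if they are adjacent in $P_d(p^{re})$ for some $e\in E$. Random graph: the countable random graph (or universal graph) $R$ of Erdős, Rényi and Rado is the countably infinite graph, unique up to isomorphism, with the following property $U$: given any two disjoint finite sets $A$ and $B$ of vertices, there is a vertex not in $A\cup B$ which is a neighbour of each vertex in $A$ and a non-neighbour of each vertex in $B$. An explicit model (Rado) has vertex set $\mathbb{N}=\{0,1,2,\ldots\}$, with vertices $x<y$ adjacent if and only if $2^x$ appears in the binary representation of $y$ as a sum of distinct powers of $2$. *)

(* Defs.v *)
From mathcomp Require Import all_boot all_order all_algebra all_field.
From mathcomp Require Import boolp classical_sets functions cardinality.

Set Implicit Arguments.
Unset Strict Implicit.
Unset Printing Implicit Defensive.

Import GRing.Theory.

Local Open Scope classical_set_scope.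

(* A graph whose vertices form a subset of an ambient type, so that graphs on
   different subfields of one field have a literal union.  Being undirected and
   loopless is the separate predicate [simple_graph]; both properties transfer
   along isomorphisms, so an isomorphism with [rado] entails them. *)
Record graph (T : Type) := Graph {
  vertices : set T;
  adj : T -> T -> Prop
}.

Definition simple_graph (T : Type) (G : graph T) : Prop :=
  [/\ forall x y, adj G x y -> vertices G x /\ vertices G y,
      forall x y, adj G x y -> adj G y x
    & forall x, ~ adj G x x].

Definition graph_isomorphic (T U : Type) (G : graph T) (H : graph U) : Prop :=
  exists2 f : T -> U,
    set_bij (vertices G) (vertices H) f &
    forall x y, vertices G x -> vertices G y ->
      (adj G x y <-> adj H (f x) (f y)).

Definition graph_union (T I : Type) (E : set I) (G : I -> graph T) : graph T :=
  Graph (\bigcup_(i in E) vertices (G i))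
        (fun x y => exists2 i, E i & adj (G i) x y).

Definition is_algebraic_closure (F : fieldType) (K : closedFieldType)
    (iota : {rmorphism F -> K}) : Prop :=
  forall x : K, algebraicOver iota x.

(* [Fq K q] is the subfield with q elements of K; when K is an algebraic
   closure of a prime field 'F_p and q is a power of p, exactly one subset S
   qualifies, so the union is that S. *)
Definition is_subfield_of_order (K : fieldType) (q : nat) (S : set K) : Prop :=
  GRing.divring_closed (mem S) /\ (S #= `I_q)%card.

Definition Fq (K : fieldType) (q : nat) : set K :=
  \bigcup_(S in [set S : set K | is_subfield_of_order q S]) S.
Arguments Fq : clear implicits.

Definition nonzero_powers (K : fieldType) (d q : nat) : set K :=
  [set (z ^+ d)%R | z in [set z | Fq K q z /\ z <> 0%R]].
Arguments nonzero_powers : clear implicits.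

Definition paley (K : fieldType) (d q : nat) : graph K :=
  Graph (Fq K q)
        (fun x y => [/\ Fq K q x, Fq K q y & nonzero_powers K d q (x - y)%R]).

Definition infinite_paley (K : fieldType) (d p r : nat) (E : set nat) :
    graph K :=
  graph_union E (fun e => paley K d (p ^ (r * e))).

Definition is_mult_order (m a r : nat) : Prop :=
  [/\ 0 < r, a ^ r = 1 %[mod m]
    & forall k, 0 < k -> a ^ k = 1 %[mod m] -> r <= k].

Definition property_U (T : Type) (G : graph T) : Prop :=
  forall A B : set T, finite_set A -> finite_set B ->
    A `<=` vertices G -> B `<=` vertices G -> A `&` B = set0 ->
    exists z, [/\ vertices G z, ~ (A `|` B) z,
                  forall a, A a -> adj G z a & forall b, B b -> ~ adj G z b].

Definition is_random_graph (T : Type) (G : graph T) : Prop :=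
  [/\ simple_graph G, countable (vertices G), infinite_set (vertices G)
    & property_U G].

(* [binary_digit x y]: 2^x occurs in the binary expansion of y. *)
Definition binary_digit (x y : nat) : bool := odd (y %/ 2 ^ x).

Definition rado : graph nat :=
  Graph setT (fun x y => (x < y /\ binary_digit x y)
                      \/ (y < x /\ binary_digit y x)).

Lemma binary_digit_addr (z n x : nat) :
  x < n -> binary_digit x (2 ^ n + z) = binary_digit x z.
Proof.
move=> xn; rewrite /binary_digit -(subnK (ltnW xn)) expnD divnMDl ?expn_gt0 //.
by rewrite oddD oddX subn_eq0 leqNgt xn.
Qed.

Lemma binary_digit_top (z n : nat) : z < 2 ^ n -> binary_digit n (2 ^ n + z).
Proof.
by move=> zn; rewrite /binary_digit divnDl // divnn expn_gt0 (divn_small zn).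
Qed.

Lemma binary_digits_exist (P : nat -> bool) (n : nat) :
  exists2 z, z < 2 ^ n & forall x, x < n -> binary_digit x z = P x.
Proof.
elim: n => [|n [z zn IH]]; first by exists 0.
have lt2 : 2 ^ n + z < 2 ^ n.+1 by rewrite expnS mul2n -addnn ltn_add2l.
case Pn: (P n); [exists (2 ^ n + z) => // | exists z] => [x|| x].
- rewrite ltnS leq_eqVlt => /orP[/eqP->|xn]; first by rewrite binary_digit_top.
  by rewrite binary_digit_addr // IH.
- exact: leq_ltn_trans (leq_addl _ _) lt2.
- rewrite ltnS leq_eqVlt => /orP[/eqP->|xn]; last exact: IH.
  by rewrite Pn /binary_digit divn_small.
Qed.

Lemma rado_property_U : property_U rado.
Proof.
move=> A B /finite_seqP[s As] /finite_seqP[t Bt] _ _ AB0.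
pose M := \max_(x <- s ++ t) x.+1.
have ltM x : A x \/ B x -> x < M.
  move=> ABx; rewrite /M (@leq_bigmax_seq _ _ xpredT succn) // mem_cat.
  by case: ABx; rewrite ?As ?Bt /= => ->; rewrite ?orbT.
have [z zM zP] := binary_digits_exist (fun x => x \in s) M.
have Mz : M < 2 ^ M + z by rewrite (leq_trans (ltn_expl M (ltnSn 1))) ?leq_addr.
exists (2 ^ M + z); split => //.
- by move=> /ltM; rewrite ltnNge (ltnW Mz).
- move=> a Aa; right; have aM : a < M by apply: ltM; left.
  split; first exact: ltn_trans Mz.
  by rewrite binary_digit_addr // zP //; move: Aa; rewrite As.
- move=> b Bb; have bM : b < M by apply: ltM; right.
  case=> [[zb _]|[_]]; first by move: (ltn_trans (ltn_trans zb bM) Mz); rewrite ltnn.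
  rewrite binary_digit_addr // zP // => bs.
  have : (A `&` B) b by split => //; rewrite As.
  by rewrite AB0.
Qed.

Lemma rado_is_random_graph : is_random_graph rado.
Proof.
split; last exact: rado_property_U.
- split=> // [x y []|x [] []]; rewrite ?ltnn //; [by right | by left].
- exact: countableP.
- exact: infinite_nat.
Qed.

(* Main.v *)
From HB Require Import structures.
Require Import Defs.
From mathcomp Require Import all_boot all_order all_algebra all_field.
From mathcomp Require Import boolp classical_sets functions cardinality.
From mathcomp Require Import zify.

(** Any two countable graphs with property U are isomorphic by back-and-forth,
    so it suffices to establish property U for the infinite Paley graph.  Given
    finitely many points [a_i] of the tower, one needs, over a large field
    [F_q] of the tower, an element [z] whose differences [z - a_i] have
    prescribed classes [(z - a_i)^((q-1)/d)] among the [d]-th roots of unity.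
    Instead of Weil's bound we use Stepanov's method in a weak form: if no such
    [z] exists, linear algebra gives a combination
      [R = sum_k P_k(X, X^q) prod_i (X - a_i)^(k_i (q-1)/d)],
    with the [P_k] of degree bounded independently of [q], vanishing to high
    order at all points of [F_q] except the [a_i].  For large [q] the degree of
    [R] is too small for this, so [R = 0]; but the products are linearly
    independent over the bounded-degree polynomials in [X] and [X^q], by
    Kummer theory with the [p^r]-power Frobenius map in the role of the Galois
    group.  A non-[d]-th power of [F_q] stays one in the tower because all the
    degrees in [E] are coprime to [d]. *)

Set Implicit Arguments.
Unset Strict Implicit.
Unset Printing Implicit Defensive.

Import GRing.Theory.

(** * Uniqueness of the random graph *)

Section BackAndForth.
Local Open Scope classical_set_scope.

(** A finite map kept as a list of pairs. The equivalence [p.1 = p'.1 <-> p.2 = p'.2] makes the list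
    single-valued and injective at once, so the notion is symmetric in the two graphs. *)
Definition partial_iso (T U : eqType) (G : graph T) (H : graph U)
    (s : seq (T * U)) : Prop :=
  (forall p, p \in s -> vertices G p.1 /\ vertices H p.2) /\
  (forall p p', p \in s -> p' \in s ->
     (p.1 = p'.1 <-> p.2 = p'.2) /\ (adj G p.1 p'.1 <-> adj H p.2 p'.2)).

Definition swap_pair (T U : Type) (p : T * U) : U * T := (p.2, p.1).

Lemma mem_swap (T U : eqType) (s : seq (T * U)) x y :
  ((y, x) \in map (@swap_pair T U) s) = ((x, y) \in s).
Proof. by apply/mapP/idP => [[[x' y'] xy [-> ->]]|xy] //; exists (x, y). Qed.

Lemma partial_iso_swap (T U : eqType) (G : graph T) (H : graph U) s :
  partial_iso G H s -> partial_iso H G (map (@swap_pair T U) s).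
Proof.
case=> sV sE; split=> [[y x]|[y x] [y' x']]; rewrite !mem_swap.
  by case/sV.
by move=> xy x'y'; have [e1 e2] := sE _ _ xy x'y'; split; apply: iff_sym.
Qed.

(** Property U of [H] is applied to the partners [A] of the listed neighbours of [x] and the
    partners [B] of the listed non-neighbours. The vertex it gives avoids both sets, hence is new.
    An [x] already listed keeps its partner. *)
Lemma partial_iso_extend (T U : eqType) (G : graph T) (H : graph U) s x :
  is_random_graph G -> is_random_graph H -> partial_iso G H s ->
  vertices G x -> exists y, partial_iso G H ((x, y) :: s).
Proof.
move=> [[_ symG irrG] _ _ _] [[_ symH irrH] _ _ UH] [sV sE] Gx.
have [[y xy]|x_new] := pselect (exists y, (x, y) \in s).
  exists y; split=> [p|p p']; rewrite !in_cons.
    by case/predU1P => [->|]; apply: sV.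
  by case/predU1P => [->|ps]; case/predU1P => [->|ps']; apply: sE.
pose A : set U := [set p.2 | p in [set p | p \in s /\ adj G x p.1]].
pose B : set U := [set p.2 | p in [set p | p \in s /\ ~ adj G x p.1]].
have fin (C : set (T * U)) : C `<=` [set` s] -> finite_set [set p.2 | p in C].
  move=> Cs; apply: finite_image; apply: sub_finite_set Cs _.
  by apply/finite_seqP; exists s.
have [|||||z [Hz zAB zA zB]] := UH A B.
- by apply: fin => p [].
- by apply: fin => p [].
- by move=> _ [p [/sV[_ ?] _] <-].
- by move=> _ [p [/sV[_ ?] _] <-].
- apply/seteqP; split => // _ [[p [ps xp] <-] [p' [p's xp'] /esym pp']].
  by have [/(proj2)/(_ pp') e _] := sE _ _ ps p's; apply: xp'; rewrite -e.
have z_new p : p \in s -> z <> p.2.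
  move=> ps zp; apply: zAB.
  by have [xp|xp] := pselect (adj G x p.1); [left|right]; exists p.
have x_new' p : p \in s -> x <> p.1.
  by move=> ps xp; apply: x_new; exists p.2; rewrite xp -surjective_pairing.
have zE p : p \in s -> (adj G x p.1 <-> adj H z p.2).
  move=> ps; split=> [xp|zp]; first by apply: zA; exists p.
  by apply: contrapT => xp; apply: (zB p.2) => //; exists p.
exists z; split=> [p|p p']; rewrite !in_cons.
  by case/predU1P => [->|/sV].
case/predU1P => [->|ps]; case/predU1P => [->|ps'] //=.
- by split; split=> // /[dup] => [/irrG|/irrH].
- split; last exact: zE.
  by split=> [/(x_new' _ ps')|/(z_new _ ps')].
- split; first by split=> /esym => [/(x_new' _ ps)|/(z_new _ ps)].
  by split=> [/symG/(zE _ ps)/symH|/symH/(zE _ ps)/symG].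
- exact: sE.
Qed.

(** One round of back-and-forth. The injective numberings [f] and [g] leave at most one vertex of
    number [n] on each side, and the back half is the forth half applied to the swapped list. *)
Lemma partial_iso_step (T U : eqType) (G : graph T) (H : graph U)
    (f : T -> nat) (g : U -> nat) n s :
  is_random_graph G -> is_random_graph H ->
  {in vertices G &, injective f} -> {in vertices H &, injective g} ->
  partial_iso G H s ->
  exists s', [/\ partial_iso G H s', {subset s <= s'},
    forall x, vertices G x -> f x = n -> exists y, (x, y) \in s'
  & forall y, vertices H y -> g y = n -> exists x, (x, y) \in s'].
Proof.
move=> rG rH f_inj g_inj.
have half (T' U' : eqType) (G' : graph T') (H' : graph U') (f' : T' -> nat) s0 :
    is_random_graph G' -> is_random_graph H' ->
    {in vertices G' &, injective f'} -> partial_iso G' H' s0 ->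
    exists s', [/\ partial_iso G' H' s', {subset s0 <= s'} &
      forall x, vertices G' x -> f' x = n -> exists y, (x, y) \in s'].
  move=> rG' rH' f'_inj s0P.
  have [[x [G'x xn]]|no_x] := pselect (exists x, vertices G' x /\ f' x = n).
    have [y xyP] := partial_iso_extend rG' rH' s0P G'x.
    exists ((x, y) :: s0); split=> // [p ps|x' G'x' x'n].
      by rewrite inE ps orbT.
    exists y; rewrite inE; apply/orP; left; apply/eqP; congr (_, _).
    by apply: f'_inj; rewrite ?inE // x'n.
  exists s0; split=> // x G'x xn; case: no_x; by exists x.
move=> sP; have [s1 [s1P ss1 s1x]] := half _ _ _ _ _ _ rG rH f_inj sP.
have [s2 [s2P ss2 s2y]] := half _ _ _ _ _ _ rH rG g_inj (partial_iso_swap s1P).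
exists (map (@swap_pair U T) s2); split.
- exact: partial_iso_swap.
- by move=> [x y] /ss1 xy; rewrite mem_swap; apply: ss2; rewrite mem_swap.
- move=> x Gx xn; have [y xy] := s1x x Gx xn; exists y.
  by rewrite mem_swap; apply: ss2; rewrite mem_swap.
- by move=> y Hy yn; have [x yx] := s2y y Hy yn; exists x; rewrite mem_swap.
Qed.

Lemma random_graph_unique (T U : eqType) (G : graph T) (H : graph U) :
  is_random_graph G -> is_random_graph H -> graph_isomorphic G H.
Proof.
move=> rG rH.
have [_ /countable_injP[f f_inj] _ _] := rG.
have [_ /countable_injP[g g_inj] _ UH] := rH.
pose X := {s | partial_iso G H s}.
have step (ns : nat * X) : exists s' : X, [/\ {subset sval ns.2 <= sval s'},
    forall x, vertices G x -> f x = ns.1 -> exists y, (x, y) \in sval s'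
  & forall y, vertices H y -> g y = ns.1 -> exists x, (x, y) \in sval s'].
  case: ns => n [s sP] /=.
  have [s' [s'P ss' s'x s'y]] := partial_iso_step n rG rH f_inj g_inj sP.
  by exists (exist _ s' s'P).
have [next nextP] := choice step.
have nil_iso : partial_iso G H [::] by split.
pose S := fix S n : X :=
  if n is n'.+1 then next (n', S n') else exist _ [::] nil_iso.
have S_mono m n : m <= n -> {subset sval (S m) <= sval (S n)}.
  elim: n => [|n IH]; first by rewrite leqn0 => /eqP->.
  rewrite leq_eqVlt => /predU1P[->//|/IH mn] p /mn.
  by have [+ _ _] := nextP (n, S n); apply.
pose R x y := exists n, (x, y) \in sval (S n).
have R_iso x y x' y' : R x y -> R x' y' ->
    [/\ vertices G x, vertices H y, x = x' <-> y = y' & adj G x x' <-> adj H y y'].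
  move=> [n xy] [n' x'y']; have [sV sE] := proj2_sig (S (maxn n n')).
  have xyM := S_mono _ _ (leq_maxl n n') _ xy.
  have x'y'M := S_mono _ _ (leq_maxr n n') _ x'y'.
  by have [? ?] := sV _ xyM; have [? ?] := sE _ _ xyM x'y'M.
have Rl x : vertices G x -> exists y, R x y.
  move=> Gx; have [_ + _] := nextP (f x, S (f x)) => /(_ x Gx erefl)[y xy].
  by exists y, (f x).+1.
have Rr y : vertices H y -> exists x, R x y.
  move=> Hy; have [_ _] := nextP (g y, S (g y)) => /(_ y Hy erefl)[x xy].
  by exists x, (g y).+1.
(* Property U for empty sets yields [y0], the default value of the total function [h] off
   [vertices G]. *)
have [|||||y0 _] := UH set0 set0; rewrite ?set0I //.
have total x : exists y, vertices G x -> R x y.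
  have [/Rl[y xy]|nGx] := pselect (vertices G x); first by exists y.
  by exists y0.
have [h hP] := choice total.
exists h.
  split=> [x Gx|x x' /set_mem Gx /set_mem Gx' hxx'|y Hy].
  - by have [] := R_iso _ _ _ _ (hP x Gx) (hP x Gx).
  - by have [_ _ [_ +] _] := R_iso _ _ _ _ (hP x Gx) (hP x' Gx'); apply.
  - have [x xy] := Rr y Hy; have [Gx _ _ _] := R_iso _ _ _ _ xy xy.
    exists x => //.
    by have [_ _ [+ _] _] := R_iso _ _ _ _ (hP x Gx) xy; apply.
by move=> x x' Gx Gx'; have [] := R_iso _ _ _ _ (hP x Gx) (hP x' Gx').
Qed.
End BackAndForth.

(** * Kummer independence *)

Section Frobenius.
Local Open Scope ring_scope.

Lemma expr_sum_pchar (R : comNzRingType) (n : nat) (I : Type) (r : seq I)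
    (P : pred I) (F : I -> R) : [pchar R].-nat n ->
  (\sum_(i <- r | P i) F i) ^+ n = \sum_(i <- r | P i) F i ^+ n.
Proof.
move=> chRn; apply: (big_morph (fun x : R => x ^+ n)) => [x y|].
  exact: exprDn_pchar.
by rewrite expr0n; case: n chRn.
Qed.

Lemma exprB_pchar (R : comNzRingType) (n : nat) (x y : R) :
  [pchar R].-nat n -> (x - y) ^+ n = x ^+ n - y ^+ n.
Proof.
move=> chRn; apply: (@addIr _ (y ^+ n)).
by rewrite -exprDn_pchar // !subrK.
Qed.

Lemma pnat_pchar_poly (R : nzRingType) (n : nat) :
  [pchar R].-nat n -> [pchar {poly R}].-nat n.
Proof. by move=> h; rewrite (eq_pnat _ (pchar_poly R)). Qed.

Lemma size_polyM_leq_S (R : nzRingType) (p p' : {poly R}) n n' :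
  (size p <= n.+1)%N -> (size p' <= n'.+1)%N -> (size (p * p')%R <= (n + n').+1)%N.
Proof. by move=> pn pn'; apply: leq_trans (size_polyMleq _ _) _; lia. Qed.

Lemma size_prod_le (R : nzRingType) (I : finType) (F : I -> {poly R}) c :
  (forall i, size (F i) <= c.+1)%N -> (size (\prod_i F i)%R <= (#|I| * c).+1)%N.
Proof.
move=> Fc; rewrite -sum_nat_const.
apply: (big_ind2 (fun (p : {poly R}) n => size p <= n.+1)%N) => [|p n p' n' pn pn'|//].
  by rewrite size_poly1.
by apply: leq_trans (size_polyMleq _ _) _; lia.
Qed.

End Frobenius.

Section KummerIndependence.
Local Open Scope ring_scope.
Variables (K : fieldType) (m d : nat) (a : 'I_m -> K).
Variables (s Q t q : nat).
Hypotheses (a_inj : injective a) (d_gt0 : (0 < d)%N) (s_gt0 : (0 < s)%N).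
Hypotheses (QE : Q = (s * d).+1) (qE : q = (t * d).+1).
Hypotheses (chQ : [pchar K].-nat Q) (chq : [pchar K].-nat q).
Hypothesis a_q : forall i, a i ^+ q = a i.

(** The polynomial P(X, X^q): the outer variable becomes X, the inner one X^q. *)
Definition subst_power (P : {poly {poly K}}) : {poly K} :=
  (map_poly (comp_poly 'X^q) P).['X].

Lemma subst_power_is_additive : zmod_morphism subst_power.
Proof. by move=> P P'; rewrite /subst_power rmorphB /= hornerD hornerN. Qed.

Lemma subst_power_is_multiplicative : monoid_morphism subst_power.
Proof.
by split=> [|P P']; rewrite /subst_power ?rmorph1 ?hornerC // rmorphM hornerM.
Qed.

HB.instance Definition _ := GRing.isZmodMorphism.Build _ _ subst_power
  subst_power_is_additive.
HB.instance Definition _ := GRing.isMonoidMorphism.Build _ _ subst_power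
  subst_power_is_multiplicative.

(** With outer degree below [q], distinct monomials go to distinct exponents [j * q + i], by
    uniqueness of division by [q], so nothing cancels. *)
Lemma subst_power_eq0 (P : {poly {poly K}}) :
  (size P <= q)%N -> subst_power P = 0 -> P = 0.
Proof.
have q_gt0 : (0 < q)%N by rewrite qE.
move=> szP evP0; apply/polyP=> i; rewrite coef0; apply/polyP => j; rewrite coef0.
have [Pi|iP] := leqP (size P) i; first by rewrite (nth_default 0 Pi) coef0.
have iq : (i < q)%N by apply: leq_trans szP.
have := congr1 (fun p : {poly K} => p`_(j * q + i)) evP0.
rewrite /= coef0 /subst_power (@horner_coef_wide _ (size P)); last exact: size_poly.
rewrite coef_sum (bigD1 (Ordinal iP)) //= big1 => [|i' ne_i'].
  rewrite addr0 coefMXn coef_map /= coef_comp_poly_Xn //.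
  by rewrite ltnNge leq_addl /= addnK dvdn_mull // mulnK.
rewrite coefMXn coef_map /= coef_comp_poly_Xn //.
case: ltnP => // le_i'; case: ifP => // /dvdnP[c cE].
have i'q : (i' < q)%N by apply: leq_trans (ltn_ord i') szP.
have : (j * q + i = c * q + i')%N by rewrite -cE subnK.
move/(congr1 (modn^~ q)); rewrite !modnMDl !modn_small // => ii'.
by move: ne_i'; rewrite -val_eqE /= ii' eqxx.
Qed.

Lemma subst_powerC (P : {poly K}) : subst_power P%:P = P \Po 'X^q.
Proof. by rewrite /subst_power map_polyC hornerC. Qed.

Lemma subst_powerX : subst_power 'X = 'X.
Proof. by rewrite /subst_power map_polyX hornerX. Qed.

(** Since [t = (q - 1) / d], each (X - a_i)^t takes values in the [d]-th roots of unity at the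
    points of F_q other than a_i. *)
Definition kummer_monomial (k : {ffun 'I_m -> 'I_d}) : {poly K} :=
  \prod_i ('X - (a i)%:P) ^+ (t * k i).

(* The factor by which the [Q]-th power multiplies [kummer_monomial k], cleared
   of denominators: the inner variable stands for [X^q], which makes
   [g_i^d = (X^q - a_i) / (X - a_i)] for [g_i = (X - a_i)^t]. *)
Definition frobenius_factor (k : {ffun 'I_m -> 'I_d}) : {poly {poly K}} :=
  \prod_i (('X - (a i)%:P%:P) ^+ (s * (d - k i))
           * (('X - (a i)%:P) ^+ (s * k i))%:P).

Lemma XsubC_pchar i : 'X^q - (a i)%:P = ('X - (a i)%:P) ^+ q.
Proof.
by rewrite exprB_pchar ?pnat_pchar_poly // -[(a i)%:P ^+ q]rmorphXn /= a_q.
Qed.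

Lemma kummer_monomial_frobenius k :
  kummer_monomial k ^+ Q * \prod_i ('X - (a i)%:P) ^+ (s * d)
  = kummer_monomial k * subst_power (frobenius_factor k).
Proof.
rewrite /kummer_monomial /frobenius_factor rmorph_prod -!prodrXl -!big_split /=.
apply: eq_bigr => i _.
rewrite rmorphM rmorphXn rmorphB /= subst_powerX !subst_powerC comp_polyC.
rewrite rmorphXn rmorphB /= comp_polyX comp_polyC XsubC_pchar -!exprM -!exprD.
congr (_ ^+ _); rewrite QE qE; have := ltn_ord (k i); move: (k i : nat) => n nd.
by rewrite mulnBr; have : (s * n <= s * d)%N by [rewrite leq_mul2l ltnW ?orbT]; lia.
Qed.

Lemma size_frobenius_factor k :
  (size (frobenius_factor k) <= (m * (s * d)).+1)%N.
Proof.
rewrite -[m in leqRHS]card_ord; apply: size_prod_le => i.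
apply: leq_trans (size_polyMleq _ _) _; rewrite size_exp_XsubC addSn /=.
rewrite -[leqRHS]addn1 leq_add ?size_polyC_leq1 //.
by rewrite leq_mul2l leq_subr orbT.
Qed.

Lemma frobenius_factor_neq0 k : frobenius_factor k != 0.
Proof.
apply/prodf_neq0 => i _; rewrite mulf_neq0 ?polyC_eq0 ?expf_neq0 //;
by rewrite polyXsubC_eq0.
Qed.

Lemma lead_coef_frobenius_factor k :
  lead_coef (frobenius_factor k) = \prod_i ('X - (a i)%:P) ^+ (s * k i).
Proof.
rewrite lead_coef_prod; apply: eq_bigr => i _.
by rewrite lead_coefM lead_coef_exp lead_coefXsubC expr1n mul1r lead_coefC.
Qed.

Lemma mup_XsubC_prod (k : {ffun 'I_m -> 'I_d}) i :
  mup (a i) (\prod_j ('X - (a j)%:P) ^+ (s * k j)) = (s * k i)%N.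
Proof.
rewrite (bigD1 i) //= mupMl ?mup_XsubCX ?eqxx //.
rewrite /root horner_prod; apply/prodf_neq0 => j ji.
rewrite horner_exp hornerXsubC expf_neq0 // subr_eq0.
by apply: contraNneq ji => /a_inj ->.
Qed.

(** Compare the orders at [a i] of the leading coefficients in the outer variable: the powers of [P]
    and [P'] contribute multiples of [Q.-1 = s * d], the factors contribute [s * k i] and
    [s * k' i], and both [k i] and [k' i] are below [d]. *)
Lemma frobenius_factor_inj (P P' : {poly {poly K}}) k k' :
  P != 0 -> P' != 0 ->
  P ^+ Q.-1 * frobenius_factor k = P' ^+ Q.-1 * frobenius_factor k' -> k = k'.
Proof.
move=> P0 P'0 eqPP'; apply/ffunP => i; apply/val_inj.
have := congr1 (mup (a i) \o lead_coef) eqPP'; rewrite /= !lead_coefM !lead_coef_exp.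
have mupX n (p : {poly K}) : p != 0 -> mup (a i) (p ^+ n) = (n * mup (a i) p)%N.
  move=> p0; elim: n => [|n IH].
    by rewrite mupNroot // /root expr0 hornerC oner_eq0.
  by rewrite exprS mupM ?expf_neq0 // IH mulSn.
rewrite !mupM ?expf_neq0 ?lead_coef_eq0 ?frobenius_factor_neq0 //.
rewrite !mupX ?lead_coef_eq0 // !lead_coef_frobenius_factor !mup_XsubC_prod.
move: (mup _ _) (mup _ _) (ltn_ord (k i)) (ltn_ord (k' i)) => v v'.
move: (k i : nat) (k' i : nat) => n n' nd n'd.
rewrite QE /= -!mulnA -!mulnDr => /eqP.
rewrite eqn_mul2l eqn0Ngt s_gt0 /= => /eqP /(congr1 (modn^~ d)).
by rewrite ![(d * _)%N]mulnC !modnMDl !modn_small.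
Qed.

(** Bounds the outer size of the coefficients after [n] eliminations starting from size [A]. It does
    not involve [q], so it is at most [q] for all large [q]. *)
Fixpoint kummer_bound n A :=
  if n is n'.+1 then kummer_bound n' (Q.+1 * A + m * (s * d)).+1 else A.

Lemma leq_kummer_bound n A : (A <= kummer_bound n A)%N.
Proof. by elim: n A => //= n IH A; apply: leq_trans (IH _); lia. Qed.

(* Shortest-relation argument, with Frobenius in the role of an automorphism:
   raising a relation to the power [Q] yields another one with proportional
   terms, and subtracting kills a term. *)
Lemma kummer_independence n A (P : {ffun 'I_m -> 'I_d} -> {poly {poly K}}) :
  (#|[pred k | P k != 0%R]| <= n)%N -> (forall k, size (P k) <= A)%N ->
  (kummer_bound n A <= q)%N ->
  \sum_k subst_power (P k) * kummer_monomial k = 0 -> forall k, P k = 0.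
Proof.
elim: n A P => [|n IH] A P.
  rewrite leqn0 => /eqP/card0_eq P0 _ _ _ k; apply/eqP.
  by have := P0 k; rewrite inE => /negbFE.
move=> cardP sizeP /= boundq relP.
case: (pickP [pred k | P k != 0%R]) => [k0|P0]; last first.
  by move=> k; apply/eqP; have /negbFE := P0 k.
move=> /= Pk0.
pose P' k := P k0 ^+ Q * frobenius_factor k0 * P k
             - P k0 * P k ^+ Q * frobenius_factor k.
have P'0 : forall k, P' k = 0.
  apply: IH boundq _ => [|k|].
  - rewrite -ltnS; apply: leq_trans cardP.
    apply: proper_card; apply/properP; split; last first.
      exists k0; rewrite inE //= /P' negbK -exprS exprSr.
      by rewrite mulrAC subrr.
    apply/fintype.subsetP => k; rewrite !inE; apply: contraNneq => Pk.
    by rewrite /P' Pk mulr0 expr0n QE /= mulr0 mul0r subrr.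
  - have sizeQ k' : (size (P k' ^+ Q) <= (A * Q).+1)%N.
      apply: leq_trans (size_poly_exp_leq _ _) _.
      by rewrite ltnS leq_mul2r (leq_trans (leq_pred _)) ?orbT.
    apply: leq_trans (size_polyD _ _) _; rewrite size_polyN geq_max.
    have sizeS k' : (size (P k') <= A.+1)%N by apply: leq_trans (sizeP k') _.
    have -> : (Q.+1 * A + m * (s * d) = A * Q + m * (s * d) + A)%N by lia.
    rewrite -[P k0 * _ * _]mulrA [P k0 * _]mulrC.
    by rewrite !size_polyM_leq_S // ?size_frobenius_factor.
  - pose W := \prod_i ('X - (a i)%:P) ^+ (s * d).
    have relQ : \sum_k subst_power (P k ^+ Q * frobenius_factor k) * kummer_monomial k = 0.
      transitivity ((\sum_k subst_power (P k) * kummer_monomial k) ^+ Q * W).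
        rewrite expr_sum_pchar ?pnat_pchar_poly // mulr_suml; apply: eq_bigr => k _.
        rewrite exprMn -mulrA kummer_monomial_frobenius rmorphM rmorphXn /=.
        by rewrite -!mulrA; congr (_ * _); rewrite mulrC.
      by rewrite relP expr0n QE mul0r.
    transitivity (subst_power (P k0 ^+ Q * frobenius_factor k0) *
        (\sum_k subst_power (P k) * kummer_monomial k)
      - subst_power (P k0)
        * \sum_k subst_power (P k ^+ Q * frobenius_factor k) * kummer_monomial k).
      rewrite !mulr_sumr -sumrB; apply: eq_bigr => k _.
      by rewrite rmorphB mulrBl -[_ * _ * frobenius_factor k]mulrA !rmorphM /= !mulrA.
    by rewrite relP relQ !mulr0 subrr.
(* If [P k] is non-zero, cancelling [P k0 * P k] in [P' k = 0] leaves exactly the identity that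
   [frobenius_factor_inj] excludes for distinct indices. *)
have only_k0 k : k != k0 -> P k = 0.
  move=> kk0; apply/eqP; apply: contraNT kk0 => Pk; apply/eqP.
  apply: (@frobenius_factor_inj (P k) (P k0)) => //.
  have PP0 : P k0 * P k != 0 by rewrite mulf_neq0.
  apply: (mulfI PP0); have /eqP := P'0 k; rewrite subr_eq0 QE !exprS /= => /eqP PP.
  rewrite -[LHS]mulrA [P k * _]mulrA -exprS mulrA -[RHS]mulrA.
  by rewrite exprS -PP -!mulrA; congr (_ * _); rewrite [RHS]mulrC mulrA.
suff Pk00 : P k0 = 0 by rewrite Pk00 eqxx in Pk0.
apply: subst_power_eq0.
  apply: leq_trans boundq; apply: leq_trans (leq_kummer_bound _ _).
  by apply: leq_trans (sizeP _) _; lia.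
move: relP; rewrite (bigD1 k0) //= big1 => [|k /only_k0 ->]; last by rewrite rmorph0 mul0r.
rewrite addr0 => /eqP; rewrite mulf_eq0 => /orP[/eqP //|].
suff /negPf-> : kummer_monomial k0 != 0 by [].
by apply/prodf_neq0 => i _; rewrite expf_neq0 // polyXsubC_eq0.
Qed.
End KummerIndependence.

(** * Stepanov's method *)

Section Stepanov.
Local Open Scope ring_scope.

Lemma nontrivial_solution (K : fieldType) (I J : finType) (F : I -> J -> K) :
  (#|J| < #|I|)%N ->
  exists2 v : I -> K, exists i, v i != 0 & forall j, \sum_i v i * F i j = 0.
Proof.
move=> JI; pose M := \matrix_(i < #|I|, j < #|J|) F (enum_val i) (enum_val j).
have /rowV0Pn[u /sub_kermxP uM u0] : kermx M != 0.
  rewrite -mxrank_eq0 mxrank_ker -lt0n subn_gt0.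
  exact: leq_ltn_trans (rank_leq_col _) JI.
exists (fun i => u 0 (enum_rank i)) => [|j].
  have [i ui] : exists i, u 0 i != 0.
    apply/existsP; apply: contraNT u0 => /existsPn ui; apply/eqP/rowP => i.
    by rewrite mxE; have /negPn/eqP := ui i.
  by exists (enum_val i); rewrite enum_valK.
have /rowP/(_ (enum_rank j)) := uM; rewrite !mxE => uMj.
rewrite -[RHS]uMj (reindex _ (onW_bij _ (@enum_val_bij I))) /=.
by apply: eq_bigr => i _; rewrite !mxE enum_valK enum_rankK.
Qed.

Lemma prod_XsubC_exp_dvdp (K : fieldType) (M : nat) (rs : seq K) (p : {poly K}) :
  uniq rs -> (forall x, x \in rs -> ('X - x%:P) ^+ M %| p) ->
  \prod_(x <- rs) ('X - x%:P) ^+ M %| p.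
Proof.
elim: rs => [|x rs IH] /=; first by rewrite big_nil dvd1p.
case/andP=> xrs uniq_rs rsp; rewrite big_cons Gauss_dvdp.
  by rewrite rsp ?mem_head ?IH // => y yrs; rewrite rsp // inE yrs orbT.
rewrite prodrXl coprimep_expl // coprimep_expr // coprimep_sym coprimep_XsubC.
by rewrite root_prod_XsubC.
Qed.

Lemma dvdp_exp_XsubC_comp (K : fieldType) (M : nat) (p : {poly K}) (x c : K) :
  c != 0 -> 'X^M %| p \Po (x%:P + c *: 'X) -> ('X - x%:P) ^+ M %| p.
Proof.
move=> c0 /dvdpP[u uE].
have := congr1 (comp_poly (c^-1 *: ('X - x%:P))) uE.
rewrite -comp_polyA comp_polyM rmorphXn /= comp_polyX.
rewrite comp_polyD comp_polyC comp_polyZ comp_polyX.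
rewrite scalerA divff // scale1r addrC subrK comp_polyXr => ->.
by rewrite dvdp_mull // exprZn dvdpZr // expf_neq0 // invr_neq0.
Qed.

(* A bivariate polynomial whose coefficient of [T^l] has degree at most
   [n + m * l] in the inner variable. *)
Definition slope_le (K : fieldType) (m n : nat) (P : {poly {poly K}}) :=
  forall l, (size (P`_l)%R <= (n + m * l).+1)%N.

Lemma slope_leM (K : fieldType) m n n' (P P' : {poly {poly K}}) :
  slope_le m n P -> slope_le m n' P' -> slope_le m (n + n') (P * P').
Proof.
move=> Pn Pn' l; rewrite coefM; apply: leq_trans (size_sum _ _ _) _.
apply/bigmax_leqP => i _; have il := ltn_ord i.
have := size_polyM_leq_S (Pn i) (Pn' (l - i)%N).
have -> : (m * l = m * i + m * (l - i))%N by rewrite -mulnDr subnKC.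
by move/leq_trans; apply; lia.
Qed.

Lemma slope_leX (K : fieldType) m n k (P : {poly {poly K}}) :
  slope_le m n P -> slope_le m (k * n) (P ^+ k).
Proof.
move=> Pn; elim: k => [|k IH] l; last by rewrite exprS mulSn; apply: slope_leM.
by rewrite expr0 coef1; case: eqP; rewrite ?size_poly1 ?size_poly0.
Qed.

Lemma slope_le_prod (K : fieldType) m (I : finType) (P : I -> {poly {poly K}}) :
  (forall i, slope_le m 0 (P i)) -> slope_le m 0 (\prod_i P i).
Proof.
move=> P0; apply: big_ind => [l|p p'|//]; last exact: slope_leM.
by rewrite coef1; case: eqP; rewrite ?size_poly1 ?size_poly0.
Qed.

Lemma slope_le_linear (K : fieldType) m n (p p' : {poly K}) :
  (size p <= n.+1)%N -> (size p' <= (n + m).+1)%N ->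
  slope_le m n (p%:P + 'X * p'%:P).
Proof.
move=> pn pn' [|[|l]]; rewrite coefD coefXM coefC /= ?addr0 ?muln0 ?addn0 //.
  by rewrite coefC /= add0r muln1.
by rewrite coefC /= addr0 size_poly0.
Qed.
End Stepanov.

(** * Local expansion of the auxiliary monomials at a fixed point of Frobenius *)

Section LocalExpansion.
Local Open Scope ring_scope.
Variables (K : fieldType) (m d : nat) (a : 'I_m -> K) (t q : nat) (omega : K).
Hypothesis chq : [pchar K].-nat q.

Notation w := (\prod_i ('X - (a i)%:P)).

Definition monomial_term (k : {ffun 'I_m -> 'I_d}) (i j : nat) : {poly K} :=
  'X^i * 'X^(q * j) * kummer_monomial a t k.

(* Expansion of [monomial_term k i j] at [X + T w(X)] modulo [T^q], for [X] a
   fixed point of the [q]-th power with [(X - a_i)^t = omega^(l i)]; the outer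
   variable is [T].  Scaling the increment by [w] avoids denominators. *)
Definition local_term (l k : {ffun 'I_m -> 'I_d}) (i j : nat)
    : {poly {poly K}} :=
  ('X%:P + 'X * w%:P) ^+ i * 'X%:P ^+ j
  * (\prod_i' (1 + 'X * (\prod_(i'' | i'' != i') ('X - (a i'')%:P))%:P)
       ^+ (t * k i'))
  * (\prod_i' omega ^+ (l i' * k i'))%:P%:P.

Lemma size_prodXsubC (P : pred 'I_m) :
  (size (\prod_(i | P i) ('X - (a i)%:P))%R <= m.+1)%N.
Proof.
by rewrite -big_filter size_prod_XsubC size_filter ltnS -sum1_count sum1_card
  -[leqRHS]card_ord max_card.
Qed.

(** The large exponents [t * k i'] cost nothing, because their bases have slope bound with constant
    term 0. Hence the bound is independent of [q]. *)
Lemma slope_local_term l k i j : slope_le m (i + j) (local_term l k i j).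
Proof.
rewrite /local_term -[(i + j)%N]addn0; apply: slope_leM; last first.
  move=> l'; rewrite coefC; case: eqP => _; rewrite ?size_poly0 //.
  by apply: leq_trans (size_polyC_leq1 _) _.
rewrite -[(i + j)%N]addn0; apply: slope_leM; last first.
  apply: slope_le_prod => i'; rewrite -[0%N](muln0 (t * k i')).
  apply: slope_leX; rewrite -(polyC1 {poly K}); apply: slope_le_linear.
    by rewrite size_poly1.
  exact: size_prodXsubC.
apply: slope_leM; rewrite -[X in slope_le _ X _]muln1; apply: slope_leX.
  apply: slope_le_linear; first by rewrite size_polyX.
  by apply: leq_trans (size_prodXsubC _) _.
by move=> l'; rewrite coefC; case: eqP; rewrite ?size_polyX ?size_poly0.
Qed.

(** At y = x + w(x) T one has y^q = x + w(x)^q T^q, which is x modulo T^q. Moreover y - a_i is x -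
    a_i times 1 + T prod_(j != i) (x - a_j), and (x - a_i)^t is replaced by its class. *)
Lemma monomial_term_local (M : nat) (x : K) (l k : {ffun 'I_m -> 'I_d}) i j :
  (M <= q)%N -> x ^+ q = x -> (forall i', (x - a i') ^+ t = omega ^+ l i') ->
  'X^M %| (monomial_term k i j \Po (x%:P + w.[x] *: 'X))
          - map_poly (horner_eval x) (local_term l k i j).
Proof.
move=> Mq xq xl; apply: (@dvdp_trans _ 'X^q); first exact: dvdp_exp2l.
set y := x%:P + _.
have yq : y ^+ q = x%:P + (w.[x] ^+ q)%:P * 'X^q.
  rewrite /y exprDn_pchar ?pnat_pchar_poly // exprZn -mul_polyC.
  by rewrite -[x%:P ^+ q]rmorphXn /= xq.
pose g := kummer_monomial a t k \Po y.
have gE : map_poly (horner_eval x)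
    (\prod_i' (1 + 'X * (\prod_(i'' | i'' != i') ('X - (a i'')%:P))%:P)
       ^+ (t * k i')) * (\prod_i' omega ^+ (l i' * k i'))%:P = g.
  rewrite /g /kummer_monomial rmorph_prod [RHS]rmorph_prod rmorph_prod -big_split /=.
  apply: eq_bigr => i' _.
  have -> : omega ^+ (l i' * k i') = (x - a i') ^+ (t * k i') by rewrite exprM -xl -exprM.
  rewrite !rmorphXn /= -exprMn; congr (_ ^+ _).
  have wx : w.[x] = (x - a i') * (\prod_(i'' | i'' != i') ('X - (a i'')%:P)).[x].
    by rewrite (bigD1 i') //= hornerM hornerXsubC.
  rewrite comp_polyB comp_polyX comp_polyC rmorphD rmorph1 rmorphM /=.
  rewrite map_polyX map_polyC /= horner_evalE /y wx.
  rewrite addrAC -polyCB -mul_polyC polyCM mulrDl mul1r; congr (_ + _).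
  by rewrite mulrC -[RHS]mulrA; congr (_ * _); rewrite mulrC.
rewrite /monomial_term !comp_polyM !rmorphXn /= comp_polyX.
have evC c : map_poly (horner_eval x) c%:P%:P = c%:P.
  by rewrite map_polyC /= horner_evalE hornerC.
rewrite /local_term 3!rmorphM /= evC -[in X in _ - X]mulrA gE -/g.
rewrite rmorphXn rmorphXn rmorphD rmorphM /=.
rewrite map_polyX !map_polyC /= !horner_evalE hornerX.
have -> : x%:P + 'X * (w.[x])%:P = y by rewrite /y mulrC mul_polyC.
rewrite -mulrBl -mulrBr dvdp_mulr // dvdp_mull //.
rewrite exprM yq subrXX addrAC subrr add0r.
by rewrite mulrAC dvdp_mull.
Qed.
End LocalExpansion.

(** * Existence of an element with prescribed classes *)

Section PrescribedClasses.
Local Open Scope ring_scope.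

(* With [D] classes, these values make the [D A B] unknowns outnumber the
   [(D - 1) M (A + B + m M)] conditions for vanishing to order [M] outside one
   class, while [M > B + m] contradicts the degree [< A + q (B + m)]. *)
Definition stepanov_bound (m d s Q : nat) : nat :=
  let D := #|{ffun 'I_m -> 'I_d}| in
  let B := (D.-1 * m.+1).+1 in
  let M := (B + m).+1 in
  let A := (D.-1 * M * (B + m * M)).+1 in
  (A + m * M + M + kummer_bound m d s Q D A)%N.

Variables (K : fieldType) (m d : nat) (a : 'I_m -> K) (s Q t q : nat).
Variables (omega : K) (rs : seq K).
Hypotheses (a_inj : injective a) (d_gt0 : (0 < d)%N) (s_gt0 : (0 < s)%N).
Hypotheses (QE : Q = (s * d).+1) (qE : q = (t * d).+1).
Hypotheses (chQ : [pchar K].-nat Q) (chq : [pchar K].-nat q).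
Hypothesis a_q : forall i, a i ^+ q = a i.
Hypothesis prim_omega : d.-primitive_root omega.
Hypotheses (rs_uniq : uniq rs) (size_rs : size rs = q).
Hypothesis rs_q : forall x, x \in rs -> x ^+ q = x.

Lemma exists_root_of_unity_class x : x \in rs -> (forall i, x != a i) ->
  exists l : {ffun 'I_m -> 'I_d}, forall i, (x - a i) ^+ t = omega ^+ l i.
Proof.
move=> xrs xa.
have xd i : ((x - a i) ^+ t) ^+ d = 1.
  have xai : x - a i != 0 by rewrite subr_eq0.
  apply: (mulfI xai); rewrite mulr1 -exprM -exprS -qE exprB_pchar //.
  by rewrite rs_q // a_q.
have ex i : exists l : 'I_d, (x - a i) ^+ t == omega ^+ l.
  by have [l ->] := prim_rootP prim_omega (xd i); exists l.
by exists [ffun i => xchoose (ex i)] => i; rewrite ffunE; apply/eqP/(xchooseP (ex i)).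
Qed.

Lemma size_monomial_term (k : {ffun 'I_m -> 'I_d}) i j :
  (size (monomial_term a t q k i j) <= (i + q * j + m * q).+1)%N.
Proof.
have szX n : (size ('X^n : {poly K}) <= n.+1)%N by rewrite size_polyXn.
rewrite /monomial_term; rewrite !size_polyM_leq_S //.
rewrite -[m in leqRHS]card_ord; apply: size_prod_le => i'.
rewrite size_exp_XsubC ltnS qE; apply: leq_trans (leqnSn _).
by rewrite leq_mul2l ltnW ?orbT.
Qed.

(* Stepanov's method: if a class were empty, a non-zero combination of few
   [monomial_term]s would vanish to high order at almost all of [rs]. *)
Lemma exists_prescribed_class (l0 : {ffun 'I_m -> 'I_d}) :
  (stepanov_bound m d s Q <= q)%N ->
  exists2 x, x \in rs & forall i, (x - a i) ^+ t = omega ^+ l0 i.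
Proof.
rewrite /stepanov_bound; set D := #|_|; set B := (D.-1 * m.+1).+1.
set M := (B + m).+1; set A := (D.-1 * M * (B + m * M)).+1 => bound_q.
have D_gt0 : (0 < D)%N by apply/card_gt0P; exists l0.
pose N := (A + B + m * M)%N.
(* [I] indexes the unknown coefficients, [J] the conditions: a wrong class, an order below [M] in T
   and a degree below [N] in X. The combined expansions must vanish identically in X rather than at
   each point, so the number of conditions does not grow with [q]. *)
pose I : finType := ({ffun 'I_m -> 'I_d} * 'I_A * 'I_B)%type.
pose J : finType := ({l : {ffun 'I_m -> 'I_d} | l != l0} * 'I_M * 'I_N)%type.
pose F (i : I) (j : J) : K :=
  (local_term a t omega (val j.1.1) i.1.1 i.1.2 i.2)`_j.1.2`_j.2.
(* The choices of [B], [M] and [A] give D B = (D - 1) M + 1 and A = (D - 1) M (B + m M) + 1, so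
   there is exactly one more unknown than conditions. *)
have cardIJ : (#|J| < #|I|)%N.
  rewrite !card_prod !card_ord card_sig -/D.
  have -> : #|[pred l | l != l0]| = D.-1 by rewrite cardC1.
  have DE : D = D.-1.+1 by rewrite prednK.
  rewrite [in ltnRHS]DE /N.
  have -> : (D.-1.+1 * A * B = (D.-1 * B + B) * A)%N by lia.
  have -> : (D.-1 * B + B = D.-1 * M + 1)%N by rewrite /M {2}/B; lia.
  rewrite mulnDl mul1n -addnA mulnDr ltn_add2l /A ltnS; lia.
have [v [i0 vi0] vF] := nontrivial_solution F cardIJ.
pose R : {poly K} := \sum_(i : I) v i *: monomial_term a t q i.1.1 i.1.2 i.2.
have sizeR : (size R <= A + q * (B + m))%N.
  apply: leq_trans (size_sum _ _ _) _; apply/bigmax_leqP => i _.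
  apply: leq_trans (size_scale_leq _ _) _.
  apply: leq_trans (size_monomial_term _ _ _) _.
  rewrite mulnDr addnA -addSn -addSn [(m * q)%N]mulnC leq_add2r leq_add //.
  by rewrite leq_mul2l ltnW ?orbT.
have R_neq0 : R != 0.
  (* [V] extends [v] by 0 to all natural indices, as [\poly] requires. Kummer independence then
     turns [R = 0] into the vanishing of every [v i]. *)
  pose V k i j := if insub i is Some i' then
      if insub j is Some j' then v ((k, i'), j') else 0 else 0.
  have VE k i j : V k (val i) (val j) = v (k, i, j) by rewrite /V !valK.
  pose P k : {poly {poly K}} := \poly_(i < A) \poly_(j < B) V k i j.
  apply: contra_neq vi0 => R0.
  have P0 : forall k, P k = 0.
    apply: (@kummer_independence _ _ _ a s Q t q _ _ _ _ _ _ _ _ D A) => //.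
    - exact: max_card.
    - by move=> k; apply: size_poly.
    - by apply: leq_trans bound_q; rewrite leq_addl.
    - rewrite -[RHS]R0.
      have -> : R = \sum_k \sum_i \sum_j v (k, i, j) *: monomial_term a t q k i j.
        by rewrite pair_bigA pair_bigA; apply: eq_bigr => [[[k i] j]].
      apply: eq_bigr => k _; rewrite /P poly_def rmorph_sum mulr_suml /=.
      apply: eq_bigr => i _.
      rewrite -mul_polyC rmorphM rmorphXn /= subst_powerX subst_powerC.
      rewrite poly_def rmorph_sum /= !mulr_suml; apply: eq_bigr => j _.
      rewrite comp_polyZ rmorphXn /= comp_polyX -exprM VE /monomial_term.
      by rewrite -!scalerAl ['X^(q * j) * _]mulrC.
  case: i0 => [[k i] j]; rewrite -VE.
  have := congr1 (fun p : {poly {poly K}} => p`_i`_j) (P0 k).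
  by rewrite /P /= coef_poly ltn_ord coef_poly ltn_ord !coef0.
apply/exists2P; apply: contrapT => no_x.
have R_vanishes x : x \in rs -> (forall i, x != a i) -> ('X - x%:P) ^+ M %| R.
  move=> xrs xa; have [l xl] := exists_root_of_unity_class xrs xa.
  have ll0 : l != l0.
    by apply/eqP => ll0; apply: no_x; exists x; split=> // i; rewrite xl ll0.
  apply: (@dvdp_exp_XsubC_comp _ _ _ _ (\prod_i ('X - (a i)%:P)).[x]).
    rewrite horner_prod; apply/prodf_neq0 => i _.
    by rewrite hornerXsubC subr_eq0.
  set y := x%:P + _.
  pose H (i : I) := local_term a t omega l i.1.1 i.1.2 i.2.
  have -> : R \Po y =
      \sum_i v i *: (monomial_term a t q i.1.1 i.1.2 i.2 \Po y
                     - map_poly (horner_eval x) (H i))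
      + \sum_i v i *: map_poly (horner_eval x) (H i).
    rewrite -big_split rmorph_sum /=; apply: eq_bigr => i _.
    by rewrite -scalerDr subrK comp_polyZ.
  apply: dvdp_add.
    apply: (big_ind (dvdp 'X^M)) => [|p p'|i _]; [exact: dvdp0 | exact: dvdp_add|].
    rewrite -mul_polyC dvdp_mull //; apply: monomial_term_local => //; last exact: rs_q.
    by apply: leq_trans bound_q; rewrite -addnA addnCA leq_addr.
  rewrite -[X in _ %| X](poly_take_drop M) (dvdp_addl _ (dvdp_mull _ (dvdpp _))).
  suff -> : take_poly M (\sum_i v i *: map_poly (horner_eval x) (H i)) = 0 by exact: dvdp0.
  apply/polyP => n; rewrite coef0 coef_take_poly; case: ifP => // nM.
  (* Coefficients in X below [N] vanish by the choice of [v], the others by the slope bound. *)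
  have H0 : \sum_i v i *: (H i)`_n = 0.
    apply/polyP => j; rewrite coef0 coef_sum.
    have [jN|Nj] := ltnP j N.
      rewrite -[RHS](vF (exist _ l ll0, Ordinal nM, Ordinal jN)).
      by apply: eq_bigr => i _; rewrite coefZ.
    rewrite big1 // => i _; rewrite coefZ nth_default ?mulr0 //.
    apply: leq_trans Nj; apply: leq_trans (slope_local_term _ _ _ _ _ _ _ _) _.
    have := ltn_ord i.1.2; have := ltn_ord i.2.
    have : (m * n <= m * M)%N by rewrite leq_mul2l ltnW ?orbT.
    rewrite /N; lia.
  transitivity (horner_eval x (\sum_i v i *: (H i)`_n)); last by rewrite H0 rmorph0.
  rewrite coef_sum rmorph_sum; apply: eq_bigr => i _.
  by rewrite coefZ coef_map /= !horner_evalE hornerZ.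
pose rs' := [seq x <- rs | [forall i, x != a i]].
have size_rs' : (q - m <= size rs')%N.
  rewrite leq_subLR -size_rs -(count_predC [pred x | [forall i, x != a i]] rs).
  rewrite size_filter addnC leq_add2r -size_filter -[leqRHS]card_ord -(size_codom a).
  apply: uniq_leq_size; first exact: filter_uniq.
  move=> x; rewrite mem_filter /= => /andP[/forallPn[i /negPn/eqP ->] _].
  exact: codom_f.
have : \prod_(x <- rs') ('X - x%:P) ^+ M %| R.
  apply: prod_XsubC_exp_dvdp; first exact: filter_uniq.
  by move=> x; rewrite mem_filter => /andP[/forallP xa xrs]; apply: R_vanishes.
move/(dvdp_leq R_neq0)/(leq_trans (leq_pred _)); rewrite prodrXl size_exp size_prod_XsubC.
have : ((q - m) * M <= size rs' * M)%N by rewrite leq_mul2r size_rs' orbT.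
(* As [M = (B + m).+1], the zeros number q (B + m) + q - m M with multiplicity, and [q] is at least
   A + m M + M, which contradicts [sizeR]. *)
have -> : ((q - m) * M = q * (B + m) + q - m * M)%N.
  by rewrite mulnBl {1}/M mulnS [(q + _)%N]addnC.
have : (0 < M)%N by [].
rewrite succnK; move: sizeR bound_q; move: (kummer_bound _ _ _ _ _ _) => b.
move: (size rs' * M)%N (q * (B + m))%N (m * M)%N (size R) (A) (M) => ? ? ? ? ? ?.
lia.
Qed.
End PrescribedClasses.

(** * Finite subfields of a closed field *)

Section SubfieldsOfClosedField.
Local Open Scope classical_set_scope.
Local Open Scope ring_scope.

Lemma card_seq_set (T : eqType) (s : seq T) :
  uniq s -> ([set` s] #= `I_(size s))%card.
Proof.
move=> s_uniq; apply/(card_set_bijP (U := nat)); exists (index^~ s); split.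
- by move=> x /=; rewrite index_mem.
- by move=> x y /set_mem /= xs /set_mem /= ys; apply: index_inj.
- move=> n /= ns; case: s s_uniq ns => // x0 s s_uniq ns.
  by exists (nth x0 (x0 :: s) n); [apply: mem_nth | apply: index_uniq].
Qed.

Variable K : closedFieldType.

Lemma unity_roots (n : nat) : n%:R != 0 :> K ->
  exists rs : seq K, [/\ uniq rs, size rs = n & forall x, (x \in rs) = (x ^+ n == 1)].
Proof.
move=> n0; have n_gt0 : (0 < n)%N by case: n n0 => //; rewrite eqxx.
have [rs] := closed_field_poly_normal ('X^n - 1 : {poly K}).
rewrite lead_coefXnsubC // scale1r => rsE; exists rs; split.
- by rewrite -separable_prod_XsubC -rsE separable_Xn_sub_1.
- by apply: succn_inj; rewrite -(size_prod_XsubC rs id) -rsE size_XnsubC.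
- by move=> x; rewrite -root_prod_XsubC -rsE rootE !hornerE subr_eq0.
Qed.

Lemma exists_prim_root (n : nat) : n%:R != 0 :> K -> exists z : K, n.-primitive_root z.
Proof.
move=> n0; have n_gt0 : (0 < n)%N by case: n n0 => //; rewrite eqxx.
have [rs [rs_uniq rs_size rsE]] := unity_roots n0.
have /hasP[z _ zP] : has n.-primitive_root rs; last by exists z.
apply: cyclic.has_prim_root => //; last by rewrite rs_size.
by apply/allP => x; rewrite rsE unity_rootE.
Qed.

Lemma expf_pred_eq1 (q : nat) (x : K) : (0 < q)%N -> x != 0 ->
  (x ^+ q.-1 == 1) = (x ^+ q == x).
Proof.
move=> q_gt0 x0; rewrite -{2}(prednK q_gt0) exprS.
by rewrite -{4}[x]mulr1 (inj_eq (mulfI x0)).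
Qed.

Lemma fixed_points_pchar (q : nat) : [pchar K].-nat q -> (1 < q)%N -> q%:R = 0 :> K ->
  exists rs : seq K, [/\ uniq rs, size rs = q & forall x, (x \in rs) = (x ^+ q == x)].
Proof.
move=> chq q_gt1 q0; have q_gt0 := ltnW q_gt1.
have [rs [rs_uniq rs_size rsE]] : exists rs : seq K,
    [/\ uniq rs, size rs = q.-1 & forall x, (x \in rs) = (x ^+ q.-1 == 1)].
  apply: unity_roots; apply: contra_eq_neq q0 => q'0.
  by rewrite -(prednK q_gt0) -natr1 q'0 add0r oner_eq0.
exists (0 :: rs); split=> /= [||x].
- by rewrite rs_uniq rsE expr0n gtn_eqF -1?ltnS 1?prednK // eq_sym oner_eq0.
- by rewrite rs_size prednK.
- rewrite inE rsE; have [->|x0] := eqVneq x 0.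
    by rewrite /= expr0n gtn_eqF // eqxx.
  exact: expf_pred_eq1.
Qed.

(** Multiplication by a non-zero [x] permutes the non-zero elements of [S]; comparing their products
    gives x^(q-1) = 1. *)
Lemma finite_subfield_exp (q : nat) (S : set K) (x : K) :
  is_subfield_of_order q S -> S x -> x ^+ q = x.
Proof.
move=> [[S1 subS divS] cardS] Sx.
have /finite_seqP[s0 Ss0] : finite_set S by apply/finite_setP; exists q.
pose s := undup s0; have s_uniq : uniq s by apply: undup_uniq.
have SE : S = [set` s] by rewrite Ss0; apply/seteqP; split=> y /=; rewrite mem_undup.
have size_s : size s = q.
  apply/(@card_eq_II _ _); apply: card_eq_trans cardS.
  by rewrite SE card_eq_sym card_seq_set.
have sP y : y \in s -> y \in mem S by move=> ys; apply: mem_set; rewrite SE.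
have Ps y : y \in mem S -> y \in s by move=> /set_mem; rewrite SE.
have xs : x \in s by apply/Ps/mem_set.
have q_gt0 : (0 < q)%N by rewrite -size_s; case: (s) xs.
have [->|x0] := eqVneq x 0; first by rewrite expr0n gtn_eqF.
apply/eqP; rewrite -expf_pred_eq1 //.
have s0E : 0 \in s by apply: Ps; rewrite -(subrr 1); apply: subS.
pose s' := rem 0 s.
have mem_s' y : (y \in s') = (y != 0) && (y \in s) by rewrite mem_rem_uniq.
have s'_uniq : uniq s' by apply: rem_uniq.
have map_uniq : uniq (map ( *%R x) s') by rewrite map_inj_uniq //; apply: mulfI.
have [_ mapE] : (size (map ( *%R x) s') = size s') * (map ( *%R x) s' =i s').
  apply: uniq_min_size => //; last by rewrite size_map.
  move=> _ /mapP[y + ->]; rewrite !mem_s' => /andP[y0 /sP ys].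
  rewrite mulf_neq0 //=; apply: Ps; rewrite -[y]invrK; apply: (divS); first exact: sP.
  by rewrite -div1r; apply: divS.
have := perm_big _ (uniq_perm map_uniq s'_uniq mapE) : \prod_(y <- _) y = \prod_(y <- s') y.
rewrite big_map big_split big_const_seq count_predT iter_mulr_1 size_rem // size_s.
move/eqP; rewrite -{2}[\prod_(y <- s') y]mul1r; apply: contraLR.
rewrite (inj_eq (mulIf _)) // prodf_seq_neq0; apply/allP => y.
by rewrite mem_s' => /andP[].
Qed.

(** The fixed points of the [q]-th power form a subfield of order [q], and by [finite_subfield_exp]
    they contain every other one. *)
Lemma Fq_pchar (q : nat) : [pchar K].-nat q -> (1 < q)%N -> q%:R = 0 :> K ->
  Fq K q = [set x | x ^+ q = x].
Proof.
move=> chq q_gt1 q0; apply/seteqP; split=> [x [S Sq Sx]|x xq].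
  exact: finite_subfield_exp Sq Sx.
exists [set x | x ^+ q = x] => //; split.
  split.
  - by apply/mem_set; rewrite /= expr1n.
  - move=> y z /set_mem /= yq /set_mem /= zq; apply/mem_set.
    by rewrite /= exprB_pchar // yq zq.
  - move=> y z /set_mem /= yq /set_mem /= zq; apply/mem_set.
    by rewrite /= exprMn exprVn yq zq.
have [rs [rs_uniq rs_size rsE]] := fixed_points_pchar chq q_gt1 q0.
have -> : [set x | x ^+ q = x] = [set` rs].
  by apply/seteqP; split=> y /=; rewrite rsE => /eqP.
by rewrite -rs_size card_seq_set.
Qed.

(** For the converse, a [d]-th root [z] of [x] exists in the closed field [K], and x^t = 1 means
    z^(q-1) = 1, which places [z] in F_q. *)
Lemma nonzero_powersP (d q t : nat) (x : K) : [pchar K].-nat q -> (1 < q)%N ->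
  q%:R = 0 :> K -> q = (t * d).+1 -> (0 < d)%N -> x != 0 ->
  nonzero_powers K d q x <-> x ^+ t = 1.
Proof.
move=> chq q_gt1 q0 qE d_gt0 x0; rewrite /nonzero_powers Fq_pchar //=; split.
  case=> z [/eqP zq /eqP z0] <-; apply/eqP.
  by rewrite -exprM mulnC -[(t * d)%N]succnK -qE expf_pred_eq1 // ltnW.
move=> xt; have [z zd] := @solve_monicpoly K d (fun i => x *+ (i == 0%N)) d_gt0.
have {}zd : z ^+ d = x.
  rewrite zd (bigD1 (Ordinal d_gt0)) //= mulr1 big1 ?addr0 // => i.
  by rewrite -val_eqE /= => /negPf->; rewrite mul0r.
exists z => //; have z0 : z != 0.
  by apply: contra_neq x0 => z0; rewrite -zd z0 expr0n eqn0Ngt d_gt0.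
split; last exact/eqP; apply/eqP; rewrite -expf_pred_eq1 ?(ltnW q_gt1) //.
by rewrite qE /= mulnC exprM zd xt.
Qed.
End SubfieldsOfClosedField.

(** * The infinite Paley graph *)

Section InfinitePaley.
Local Open Scope classical_set_scope.
Local Open Scope ring_scope.

Variables (p d r : nat) (E : set nat) (K : closedFieldType).
Hypotheses (p_prime : prime p) (chp : p \in [pchar K]) (d_ge2 : (2 <= d)%N).
Hypothesis coprime_dp : coprime d p.
Hypothesis r_order : is_mult_order (if p == 2 then d else 2 * d)%N p r.
Hypothesis E_infinite : infinite_set E.
Hypothesis E_pos : forall e, E e -> (0 < e)%N.
Hypothesis E_coprime : forall e, E e -> coprime e d.
Hypothesis E_lcm : forall e f, E e -> E f -> E (lcmn e f).

Let d_gt0 : (0 < d)%N := ltnW d_ge2.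
Let r_gt0 : (0 < r)%N. Proof. by case: r_order. Qed.
Let q e := (p ^ (r * e))%N.

Let chq e : [pchar K].-nat (q e).
Proof. by rewrite pnatX pnatE // chp. Qed.

Let q_gt1 e : E e -> (1 < q e)%N.
Proof.
move=> /E_pos e_gt0; rewrite -(exp1n (r * e)) ltn_exp2r ?prime_gt1 //.
by rewrite muln_gt0 r_gt0.
Qed.

Let q0 e : E e -> (q e)%:R = 0 :> K.
Proof.
move=> /E_pos e_gt0; apply/eqP; rewrite natrX expf_eq0 muln_gt0 r_gt0 e_gt0.
by rewrite (pcharf0 chp) eqxx.
Qed.

(** For odd [p] the order is taken modulo 2d, which makes the cofactor [s] even. This parity passes
    to every level and gives the symmetry of adjacency. *)
Let p_r_pred : exists2 s, (p ^ r = (s * d).+1)%N & (p != 2)%N -> ~~ odd s.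
Proof.
have p_r_gt0 : (0 < p ^ r)%N by rewrite expn_gt0 prime_gt0.
have [_ /eqP + _] := r_order; rewrite eqn_mod_dvd // => /dvdnP[t].
move/(congr1 succn).
rewrite subn1 prednK //; case: eqP => [_|_] ->; first by exists t.
by exists (t * 2)%N; [rewrite mulnA | rewrite muln2 odd_double].
Qed.

Let q_pred e : exists2 t, q e = (t * d).+1 & (p != 2)%N -> ~~ odd t.
Proof.
rewrite /q expnM; have [s -> s_even] := p_r_pred.
elim: e => [|e [t te t_even]]; first by exists 0%N.
exists (s * (t * d).+1 + t)%N; first by rewrite expnS te; lia.
by move=> p2; rewrite oddD oddM (negPf (s_even p2)) (negPf (t_even p2)).
Qed.

Let FqE e : E e -> Fq K (q e) = [set x | x ^+ q e = x].
Proof. by move=> Ee; rewrite Fq_pchar ?q0 ?q_gt1. Qed.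

Lemma exp_dvd_fixed e f (x : K) : (e %| f)%N -> x ^+ q e = x -> x ^+ q f = x.
Proof.
move=> /dvdnP[n ->] xq; rewrite /q mulnCA [(n * _)%N]mulnC expnM.
elim: n => [|n IH]; first by rewrite expr1.
by rewrite expnS exprM xq.
Qed.

Notation G := (infinite_paley K d p r E).

Lemma infinite_paley_vertexP x : vertices G x <-> exists2 e, E e & x ^+ q e = x.
Proof.
split=> [[e Ee] /=|[e Ee xq]]; first by rewrite FqE //; exists e.
by exists e => //=; rewrite FqE.
Qed.

Lemma infinite_paley_simple : simple_graph G.
Proof.
split=> [x y [e Ee [ex ey _]]|x y [e Ee [ex ey xy]]|x [e Ee [_ _]]].
- by split; exists e.
- exists e => //; split=> //; have [t qE t_even] := q_pred e.
  have [xy0|xy0] := eqVneq (x - y) 0.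
    case: xy => z [_ /eqP/negPf z0] /eqP.
    by rewrite xy0 expf_eq0 d_gt0 z0.
  have yx0 : y - x != 0 by rewrite -opprB oppr_eq0.
  have powP := @nonzero_powersP K d (q e) t _ (chq e) (q_gt1 Ee) (q0 Ee) qE d_gt0.
  move/powP: xy => /(_ xy0) xyt; apply/powP => //.
  (* Here (-1)^t = 1: in characteristic 2 because -1 = 1, otherwise because [t] is even. *)
  rewrite -opprB exprNn xyt mulr1; have [p2|/t_even/negPf t_odd] := eqVneq p 2%N.
    by rewrite (oppr_pchar2 _) ?expr1n // -p2.
  by rewrite -signr_odd t_odd.
- case=> z [_ /eqP/negPf z0] /eqP.
  by rewrite subrr expf_eq0 d_gt0 z0.
Qed.

Lemma infinite_paley_countable : countable (vertices G).
Proof.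
apply: bigcup_countable => [|e Ee]; first exact: countableP.
apply: finite_set_countable; rewrite /= FqE //.
have [rs [_ _ rsE]] := fixed_points_pchar (chq e) (q_gt1 Ee) (q0 Ee).
apply/finite_seqP; exists rs; apply/seteqP.
by split=> x /=; rewrite rsE => /eqP.
Qed.

(** An infinite [E] contains a level beyond [N], and least common multiples with the levels of the
    points only enlarge it. *)
Lemma exists_large_common_level (s : seq K) N : (forall x, x \in s -> vertices G x) ->
  exists e, [/\ E e, (N <= q e)%N & forall x, x \in s -> x ^+ q e = x].
Proof.
elim: s => [_|y s IH sG].
  have [e [Ee Ne]] : exists e, E e /\ (N <= e)%N.
    apply: contrapT => noe; apply: E_infinite.
    apply: (@sub_finite_set _ _ `I_N) => // e Ee /=.
    by rewrite ltnNge; apply/negP => Ne; apply: noe; exists e.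
  exists e; split=> //; apply: (leq_trans Ne).
  apply: leq_trans (ltnW (ltn_expl _ (prime_gt1 p_prime))).
  by rewrite leq_pmull.
have [x xs|e [Ee Ne es]] := IH; first by apply: sG; rewrite inE xs orbT.
have /infinite_paley_vertexP[f Ef yf] : vertices G y by apply: sG; rewrite mem_head.
exists (lcmn e f); split=> [||x].
- exact: E_lcm.
- apply: (leq_trans Ne); rewrite leq_exp2l ?prime_gt1 // leq_mul2l.
  by rewrite dvdn_leq ?orbT ?dvdn_lcml // E_pos //; apply: E_lcm.
- rewrite inE => /predU1P[->|/es xe]; last by apply: exp_dvd_fixed xe; apply: dvdn_lcml.
  by apply: exp_dvd_fixed yf; apply: dvdn_lcmr.
Qed.

(* [d] does not divide the degree [f / e] of any extension inside the tower, so
   an element outside the [d]-th powers stays outside them. *)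
Lemma infinite_paley_not_adj e t (omega x y : K) : E e -> q e = (t * d).+1 ->
  d.-primitive_root omega -> (x - y) ^+ t = omega -> ~ adj G x y.
Proof.
move=> Ee qE prim xyt [f Ef [_ _ [z []]]]; rewrite FqE //= => zf z0 zd.
(* The [q e]-th power map multiplies [z] by [omega] and fixes [omega], so its [n]-th iterate
   multiplies [z] by [omega ^+ n]. *)
have ze : z ^+ q e = omega * z by rewrite qE exprSr mulnC exprM zd xyt.
have omega_q : omega ^+ q e = omega.
  by rewrite qE exprS mulnC exprM (prim_expr_order prim) expr1n mulr1.
have [Elcm] := (E_lcm Ee Ef, dvdn_lcml e f); case/dvdnP=> n lcmE.
have z_lcm : z ^+ q (lcmn e f) = z by apply: exp_dvd_fixed zf; apply: dvdn_lcmr.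
have : z ^+ q (lcmn e f) = omega ^+ n * z.
  rewrite lcmE /q mulnCA [(n * _)%N]mulnC expnM.
  elim: n {lcmE} => [|n IH]; first by rewrite expr1 mul1r.
  rewrite expnSr exprM IH exprMn -/(q e) ze exprAC omega_q.
  by rewrite mulrA exprSr.
rewrite z_lcm => /esym/eqP; rewrite -{2}[z]mul1r (inj_eq (mulIf _)); last exact/eqP.
(* Now [omega ^+ n = 1], so [d] divides [n] and hence [lcmn e f], an element of [E] and so coprime
   to [d]. *)
rewrite -(prim_order_dvd prim) => dn.
have : (d %| gcdn (lcmn e f) d)%N by rewrite dvdn_gcd dvdnn lcmE dvdn_mulr.
by rewrite (eqP (E_coprime Elcm)) dvdn1 => /eqP d1; have := d_ge2; rewrite d1.
Qed.

Lemma infinite_paley_property_U : property_U G.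
Proof.
move=> A B /finite_seqP[sA AE] /finite_seqP[sB BE] AG BG AB0.
pose s := undup (sA ++ sB); pose m := size s.
pose a (i : 'I_m) := nth 0 s i.
have a_inj : injective a.
  by move=> i j /eqP; rewrite nth_uniq ?undup_uniq // => /eqP/val_inj.
have sP x : x \in s <-> A x \/ B x.
  rewrite mem_undup mem_cat AE BE /=; split=> [/orP[]|[]->]; rewrite ?orbT //; by [left|right].
have aP x : x \in s -> exists i, x = a i.
  move=> xs; have xm : (index x s < m)%N by rewrite index_mem.
  by exists (Ordinal xm); rewrite /a nth_index.
have d0 : d%:R != 0 :> K.
  by rewrite -(dvdn_pcharf chp) -prime_coprime // coprime_sym.
have [omega prim] := exists_prim_root d0.
have [s0 s0E _] := p_r_pred.
have s0_gt0 : (0 < s0)%N.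
  by case: s0 s0E => // /eqP; rewrite -(expn0 p) eqn_exp2l ?prime_gt1 // gtn_eqF.
have [x /sP[/AG|/BG]//|e [Ee bound_e es]] :=
  @exists_large_common_level s (stepanov_bound m d s0 (p ^ r)).
have [t qE _] := q_pred e.
have [rs [rs_uniq rs_size rsE]] := fixed_points_pchar (chq e) (q_gt1 Ee) (q0 Ee).
(* Class 0 means a [d]-th power, for the points of [A]. Class 1, available since [d] is at least 2,
   gives the primitive root [omega], for the points of [B]. *)
pose l0 := [ffun i : 'I_m => if a i \in sA then Ordinal d_gt0 else Ordinal d_ge2].
have chQ : [pchar K].-nat (p ^ r)%N by rewrite pnatX pnatE // chp.
have rs_q x : x \in rs -> x ^+ q e = x by rewrite rsE => /eqP.
have a_q i : a i ^+ q e = a i by apply: es; apply: mem_nth.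
have [z zrs zl0] := exists_prescribed_class a_inj d_gt0 s0_gt0 s0E qE chQ (chq e)
  a_q prim rs_uniq rs_size rs_q l0 bound_e.
have Ez : Fq K (q e) z by rewrite FqE //=; apply: rs_q.
have t_gt0 : (0 < t)%N by have := q_gt1 Ee; rewrite qE; case: (t).
have omega0 : omega != 0.
  apply/eqP => w0; have /eqP := prim_expr_order prim.
  by rewrite w0 expr0n gtn_eqF // eq_sym oner_eq0.
have z_new x : x \in s -> z - x != 0.
  case/aP=> i ->; apply/eqP => zi; have /eqP := zl0 i.
  by rewrite zi expr0n gtn_eqF // eq_sym expf_eq0 (negPf omega0) andbF.
exists z; split.
- by exists e.
- by move/sP/z_new; rewrite subrr eqxx.
- move=> x Ax; have xs : x \in s by apply/sP; left.
  exists e => //; split=> //; first by rewrite FqE //=; apply: es.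
  apply/(@nonzero_powersP K d (q e) t _ (chq e) (q_gt1 Ee) (q0 Ee) qE d_gt0); first exact: z_new.
  have [i xi] := aP x xs; rewrite xi zl0 ffunE -xi ifT //.
  by move: Ax; rewrite AE.
- move=> x Bx; have [i xi] : exists i, x = a i by apply/aP/sP; right.
  apply: infinite_paley_not_adj Ee qE prim _; rewrite xi zl0 ffunE -xi ifF ?expr1 //.
  apply/negP => xA; have : (A `&` B) x by split=> //; rewrite AE.
  by rewrite AB0.
Qed.

Lemma infinite_paley_is_random_graph : is_random_graph G.
Proof.
split.
- exact: infinite_paley_simple.
- exact: infinite_paley_countable.
- move=> G_fin.
  (* Were the vertex set finite, property U with [B] the whole of it would give a vertex outside
     it. *)
  have [|||||z [Gz []]] := @infinite_paley_property_U set0 (vertices G); rewrite ?set0I //.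
  by right.
- exact: infinite_paley_property_U.
Qed.
End InfinitePaley.

Theorem mainTheorem2 (p d r : nat) (E : set nat)
    (K : closedFieldType) (iota : {rmorphism 'F_p -> K})
    (p_prime : prime p)
    (d_ge2 : 2 <= d)
    (coprime_dp : coprime d p)
    (r_order : is_mult_order (if p == 2 then d else 2 * d) p r)
    (E_infinite : infinite_set E)
    (E_pos : forall e, E e -> 0 < e)
    (E_coprime : forall e, E e -> coprime e d)
    (E_divisors : forall e f, E e -> f %| e -> E f)
    (E_lcm : forall e f, E e -> E f -> E (lcmn e f))
    (K_closure : is_algebraic_closure iota) :
  graph_isomorphic (infinite_paley K d p r E) rado.
Proof.
apply: random_graph_unique rado_is_random_graph.
have chp : p \in [pchar K]%R by apply: (rmorph_pchar iota); apply: pchar_Fp.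
exact: infinite_paley_is_random_graph.
Qed.
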